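(* Let $\mathcal A$ be a unital $C^*$-algebra, $G$ a locally compact group, and $\alpha:G\to\mathrm{aut}\,\mathcal A$ a strongly continuous action. Define $C(X):=(\mathcal A\cap\mathcal A')^\alpha$ (so that $\mathcal A$ is a $C(X)$-algebra) and $\mathcal G:=X\times G$. Then there is a unique fibred action $\widetilde\alpha:\mathcal G\times_X\widehat{\mathcal A}\to\widehat{\mathcal A}$ such that $\alpha$ is the action associated with $\widetilde\alpha$, i.e. $$\widetilde\alpha^x_{(x,g)}\circ\pi_x=\pi_x\circ\alpha_g,\qquad g\in G,\ x\in X.$$
   Context: $X$ is the compact Hausdorff spectrum of the unital Abelian $C^*$-algebra $(\mathcal A\cap\mathcal A')^\alpha$ of $\alpha$-invariant elements of the centre. A unital $C(X)$-algebra is a unital $C^*$-algebra $\mathcal A$ with a unital morphism from $C(X)$ into its centre; for $x\in X$, $\mathcal A_x$ is the quotient of $\mathcal A$ by the ideal $\{fa:f\in C(X),f(x)=0,a\in\mathcal A\}$ and $\pi_x:\mathcal A\to\mathcal A_x$ the quotient map. $\widehat{\mathcal A}:=\bigsqcup_x\mathcal A_x$, with projection $Q:\widehat{\mathcal A}\to X$, has the topology with basis $\{\sigma:Q(\sigma)\in U,\ \|\sigma-\pi_{Q(\sigma)}(a)\|<\varepsilon\}$, $U\subseteq X$ open, $a\in\mathcal A$, $\varepsilon>0$. A fibred action of a group bundle $p:\mathcal G\to X$ (here the trivial bundle $X\times G\to X$, with fibres $G_x=\{x\}\times G$) on $\mathcal A$ is a family $\widetilde\alpha=\{\widetilde\alpha^x:G_x\to\mathrm{aut}\,\mathcal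 A_x\}_{x\in X}$ of strongly continuous actions such that the map $\mathcal G\times_X\widehat{\mathcal A}\to\widehat{\mathcal A}$, $(y,\sigma)\mapsto\widetilde\alpha^x_y(\sigma)$, $x=p(y)=Q(\sigma)$, is continuous. *)

(* Defs.v *)
From HB Require Import structures.
From mathcomp Require Import all_boot all_order all_algebra.
From mathcomp Require Import all_classical all_reals all_analysis.
From mathcomp.real_closed Require Import complex.

Set Implicit Arguments.
Unset Strict Implicit.
Unset Printing Implicit Defensive.

Import Order.TTheory GRing.Theory Num.Theory.
Import numFieldNormedType.Exports.

Local Open Scope classical_set_scope.
Local Open Scope ring_scope.
Local Open Scope complex_scope.

(* The norm is a real-valued operation of the structure, because HB admits no
   join of the rings with the library's normed modules: the norm of a numDomainType
   takes its values in that type itself. *)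
HB.mixin Record isCStarAlgebra (R : realType) A & GRing.Algebra R[i] A := {
  star : A -> A ;
  cnorm : A -> R ;
  starD : {morph star : a b / a + b} ;
  starZ : forall (k : R[i]) (a : A), star (k *: a) = k^* *: star a ;
  starM : forall a b : A, star (a * b) = star b * star a ;
  starK : involutive star ;
  cnorm0_eq0 : forall a : A, cnorm a = 0 -> a = 0 ;
  cnormZ : forall (k : R[i]) (a : A), (cnorm (k *: a))%:C = `|k| * (cnorm a)%:C ;
  ler_cnormD : forall a b : A, cnorm (a + b) <= cnorm a + cnorm b ;
  ler_cnormM : forall a b : A, cnorm (a * b) <= cnorm a * cnorm b ;
  cnorm_starM : forall a : A, cnorm (star a * a) = cnorm a ^+ 2 ;
  cnorm_complete : forall u : nat -> A,
    (forall e : R, 0 < e -> exists N : nat, forall m n : nat,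
       (N <= m)%N -> (N <= n)%N -> cnorm (u m - u n) < e) ->
    exists l : A, forall e : R, 0 < e -> exists N : nat, forall n : nat,
       (N <= n)%N -> cnorm (u n - l) < e
}.

#[short(type="cstarAlgType")]
HB.structure Definition CStarAlgebra (R : realType) :=
  {A of GRing.Algebra R[i] A & isCStarAlgebra R A}.

HB.mixin Record isTopologicalGroup G & Group G & Topological G := {
  mulg_continuous : continuous (fun p : G * G => (p.1 * p.2)%g) ;
  invg_continuous : continuous (fun g : G => g^-1%g)
}.

#[short(type="topologicalGroupType")]
HB.structure Definition TopologicalGroup :=
  {G of Group G & Topological G & isTopologicalGroup G}.

(* Bare operations, without axioms, so that actions on a C*-algebra and on its
   quotients are instances of one definition. *)
Record star_ops (R : realType) := StarOps {
  ops_car :> Type ;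
  oadd : ops_car -> ops_car -> ops_car ;
  osub : ops_car -> ops_car -> ops_car ;
  omul : ops_car -> ops_car -> ops_car ;
  oscale : R[i] -> ops_car -> ops_car ;
  ostar : ops_car -> ops_car ;
  onorm : ops_car -> R
}.

Definition cstar_ops (R : realType) (A : cstarAlgType R) : star_ops R :=
  @StarOps R A +%R (fun a b => a - b) *%R *:%R star cnorm.

(* Preservation of the unit follows from surjectivity. *)
Definition star_automorphism (R : realType) (O : star_ops R) (f : O -> O) : Prop :=
  [/\ bijective f,
      {morph f : s t / oadd s t},
      {morph f : s t / omul s t},
      forall k : R[i], {morph f : s / oscale k s} &
      {morph f : s / ostar s}].

Record strongly_continuous_action (R : realType) (G : topologicalGroupType)
    (O : star_ops R) (act : G -> O -> O) : Prop := StronglyContinuousAction {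
  act_aut : forall g, star_automorphism (act g) ;
  actM : forall g h s, act (g * h)%g s = act g (act h s) ;
  act_continuous : forall s g (e : R), 0 < e ->
    \forall h \near g, onorm (osub (act h s) (act g s)) < e
}.

Record cstar_action (R : realType) (G : topologicalGroupType)
    (A : cstarAlgType R) := CStarAction {
  cstar_act :> G -> A -> A ;
  cstar_actP : strongly_continuous_action (O := cstar_ops A) cstar_act
}.

Section Spectrum.
Variables (R : realType) (C : algType R[i]).

Definition character (chi : C -> R[i]) : Prop :=
  linear (chi : C -> R[i]^o) /\ monoid_morphism chi.

(* The Gelfand spectrum, with the topology of pointwise convergence. *)
Definition spectrum := set_type [set chi : {ptws C -> R[i]^o} | character chi].

Definition gelfand (f : C) (x : spectrum) : R[i] := set_val x f.

End Spectrum.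

Section InvariantCentre.
Variables (R : realType) (G : topologicalGroupType) (A : cstarAlgType R).
Variable alpha : cstar_action G A.

Definition in_invariant_centre : {pred A} :=
  fun z => `[< (forall a, z * a = a * z) /\ (forall g, alpha g z = z) >].

Lemma invariant_centreP z :
  reflect ((forall a, z * a = a * z) /\ (forall g, alpha g z = z))
    (z \in in_invariant_centre).
Proof. exact: asboolP. Qed.

Lemma in_invariant_centre_subalg : GRing.subsemialg_closed in_invariant_centre.
Proof.
have aut g := act_aut (cstar_actP alpha) g.
have aD g y z : alpha g (y + z) = alpha g y + alpha g z.
  by have [_ h _ _ _] := aut g; exact: h.
have aM g y z : alpha g (y * z) = alpha g y * alpha g z.
  by have [_ _ h _ _] := aut g; exact: h.
have aZ g (k : R[i]) z : alpha g (k *: z) = k *: alpha g z.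
  by have [_ _ _ h _] := aut g; exact: h.
split.
- apply/invariant_centreP; split=> [a|g]; first by rewrite mul1r mulr1.
  have [[f' fK f'K] _ _ _ _] := aut g.
  by rewrite -[LHS]mul1r -[X in X * _]f'K -aM mulr1 f'K.
- split=> [|y z /invariant_centreP[yC yf] /invariant_centreP[zC zf]];
    apply/invariant_centreP; split=> [a|g].
  + by rewrite mul0r mulr0.
  + by have := aZ g 0 0; rewrite !scale0r.
  + by rewrite mulrDl mulrDr yC zC.
  + by rewrite aD yf zf.
- move=> k z /invariant_centreP[zC zf]; apply/invariant_centreP; split=> [a|g].
    by rewrite -scalerAl -scalerAr zC.
  by rewrite aZ zf.
- move=> y z /invariant_centreP[yC yf] /invariant_centreP[zC zf]; apply/invariant_centreP; split=> [a|g].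
    by rewrite -mulrA zC mulrA yC mulrA.
  by rewrite aM yf zf.
Qed.

Record invariant_centre := InvariantCentre {
  invariant_centre_val : A ;
  _ : invariant_centre_val \in in_invariant_centre
}.

HB.instance Definition _ := [isSub for invariant_centre_val].
HB.instance Definition _ := [Choice of invariant_centre by <:].
HB.instance Definition _ := GRing.SubChoice_isSubAlgebra.Build _ A _
  invariant_centre in_invariant_centre_subalg.

End InvariantCentre.

(* The operations act on arbitrarily chosen elements of the cosets, which makes
   sense for every set J; they are the usual quotient operations as soon as J is
   a two-sided ideal closed under star. *)
Section Quotient.
Variables (R : realType) (A : cstarAlgType R) (J : set A).

Definition coset_mod (a : A) : set A := [set a + j | j in J].

Definition quotient := set_type (range coset_mod).

Definition qproj (a : A) : quotient := SigSub (mem_set (imageT coset_mod a)).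

Definition qrepr (s : quotient) : A := xget 0 (set_val s).

Definition qadd (s t : quotient) := qproj (qrepr s + qrepr t).
Definition qsub (s t : quotient) := qproj (qrepr s - qrepr t).
Definition qmul (s t : quotient) := qproj (qrepr s * qrepr t).
Definition qscale (k : R[i]) (s : quotient) := qproj (k *: qrepr s).
Definition qstar (s : quotient) := qproj (star (qrepr s)).

Definition qnorm (s : quotient) : R := inf [set cnorm b | b in set_val s].

Definition quotient_ops : star_ops R :=
  @StarOps R quotient qadd qsub qmul qscale qstar qnorm.

End Quotient.

(* A unital C(X)-algebra A, with structure morphism theta, where C(X) is given
   as the abstract commutative algebra C whose spectrum is X: f in C is the
   function x |-> gelfand f x. *)
Section Bundle.
Variables (R : realType) (C : algType R[i]) (A : cstarAlgType R).
Variable theta : C -> A.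
Local Notation X := (spectrum C).

Definition fibre_ideal (x : X) : set A :=
  [set theta f * a | f in [set f | gelfand f x = 0] & a in [set: A]].

Definition fibre (x : X) : star_ops R := quotient_ops (fibre_ideal x).

Definition fibre_proj (x : X) : A -> fibre x := @qproj R A (fibre_ideal x).

Definition cx_bundle := {x : X & fibre x}.

Definition cx_bundle_proj (s : cx_bundle) : X := projT1 s.

Definition tube (U : set X) (a : A) (e : R) : set cx_bundle :=
  [set s | U (cx_bundle_proj s) /\
    onorm (osub (projT2 s) (fibre_proj (cx_bundle_proj s) a)) < e].

Definition tubes : set (set cx_bundle) :=
  [set T | exists U a e, [/\ open U, 0 < e & T = tube U a e]].

(* The tubes form a basis, so the topology they generate is the one having them
   as a basis; declaring them as a subbase needs no proof of that. *)
HB.instance Definition _ := gen_eqMixin cx_bundle.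
HB.instance Definition _ := gen_choiceMixin cx_bundle.
HB.instance Definition _ :=
  @isSubBaseTopological.Build cx_bundle (set cx_bundle) tubes id.

Section FibredAction.
Variable G : topologicalGroupType.

(* act x g is the automorphism of the fibre over x given by the element (x, g)
   of the fibre {x} * G of the trivial group bundle X * G -> X. *)
Variable act : forall x : X, G -> fibre x -> fibre x.

(* Only the values on X * G times_X bundle, i.e. at the points
   ((x, g), s) with x = cx_bundle_proj s, are meaningful. *)
Definition bundle_act (p : (X * G) * cx_bundle) : cx_bundle :=
  existT fibre (cx_bundle_proj p.2)
    (act p.1.2 (projT2 p.2 : fibre (cx_bundle_proj p.2))).

Record fibred_action : Prop := FibredAction {
  fibred_action_fibre : forall x, strongly_continuous_action (@act x) ;
  fibred_action_continuous :
    {within [set p : (X * G) * cx_bundle | p.1.1 = cx_bundle_proj p.2],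
      continuous bundle_act}
}.

End FibredAction.
End Bundle.

(* Main.v *)
Require Import Defs.
From HB Require Import structures.
From mathcomp Require Import all_boot all_order all_algebra.
From mathcomp Require Import all_classical all_reals all_analysis.
From mathcomp.real_closed Require Import complex.
From mathcomp Require Import ring lra.

(** The action on the fibre over [x] can only be [pi_x a |-> pi_x (alpha g a)],
since every element of the fibre is some [pi_x a]; this gives uniqueness.

For existence the issue is that the ideal of [x], the set of all products
[f a] with [f] an invariant central element vanishing at [x], has to be a
self-adjoint two-sided ideal, stable under the action. Stability is clear, as
[alpha g (f a) = f (alpha g a)], and so are the two multiplication properties.
Closure under addition is a factorization theorem: if [f] and [g] vanish at [x],
then the positive element [h = (|f|^2 + |g|^2)^(1/4)] of the invariant centre
divides both of them and vanishes at [x], so that [f a + g b = h (f' a + g' b)]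
([common_factor], [fibre_ideal_star_ideal]). As [h] is self-adjoint, the same
factorization gives closure under the involution without knowing that
characters preserve it.

The factorization takes place in the invariant centre, which is a commutative
C*-algebra: it is complete because each [alpha g] is contractive
([cnorm_star_automorphism]). It uses the little of the functional calculus that
can be had without spectral theory. Positivity of a self-adjoint [p] is expressed
by [|t - p| <= t] for some [t]; such a [p] has a square root, found by iteration
([positive_sqrt]). Consequently a self-adjoint [a] with [|a| <= 1] is the real
part of a unitary [a + i b] with [b = sqrt (1 - a^2)], and since unitaries have
norm [1] this yields positivity of squares, contractivity of *-automorphisms and
monotonicity of the norm on positive elements ([cnorm_positive_le]). The quotient
of [f] by [h] is then the limit of [f / (h + e)] when [e] tends to [0].

Continuity on the bundle rests on the upper semicontinuity of
[x |-> |pi_x a|] ([near_fibre_norm]) and on contractivity of the fibre actions. *)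

Set Implicit Arguments.
Unset Strict Implicit.
Unset Printing Implicit Defensive.
Import Order.TTheory GRing.Theory Num.Theory.
Import numFieldNormedType.Exports.
Local Open Scope classical_set_scope.
Local Open Scope ring_scope.
Local Open Scope complex_scope.

(** * Norm and involution *)

Section CStarBasics.
Variables (R : realType) (A : cstarAlgType R).
Implicit Types (a b : A) (s t : R) (u v : nat -> A).

Lemma cnormZ_real t a : cnorm (t%:C *: a) = `|t| * cnorm a.
Proof.
by apply: complexI; rewrite cnormZ rmorphM/= normc_def/= expr0n addr0 sqrtr_sqr.
Qed.

Lemma cnorm0 : cnorm (0 : A) = 0.
Proof. by rewrite -(scale0r 0) cnormZ_real normr0 mul0r. Qed.

Lemma cnormN a : cnorm (- a) = cnorm a.
Proof. by rewrite -scaleN1r -(rmorphN1 (real_complex R)) cnormZ_real normrN1 mul1r. Qed.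

Lemma cnormBC a b : cnorm (a - b) = cnorm (b - a).
Proof. by rewrite -cnormN opprB. Qed.

Lemma ler_cnormB a b : cnorm (a - b) <= cnorm a + cnorm b.
Proof. by rewrite -(cnormN b) ler_cnormD. Qed.

Lemma cnorm_ge0 a : 0 <= cnorm a.
Proof. by have := ler_cnormB a a; rewrite subrr cnorm0; lra. Qed.

Lemma ler_cnorm_dist b a c : cnorm (a - c) <= cnorm (a - b) + cnorm (b - c).
Proof. by rewrite -[in leLHS](subrK b a) -addrA ler_cnormD. Qed.

Lemma star0 : star (0 : A) = 0.
Proof. by apply: (addIr (star 0)); rewrite -starD !add0r. Qed.

Lemma star1 : star (1 : A) = 1.
Proof. by rewrite -[LHS]mulr1 -[in X in star 1 * X](starK 1) -starM mulr1 starK. Qed.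

Lemma starN a : star (- a) = - star a.
Proof. by apply: (addIr (star a)); rewrite -starD !addNr star0. Qed.

Lemma starB a b : star (a - b) = star a - star b.
Proof. by rewrite starD starN. Qed.

Lemma starZ_real t a : star (t%:C *: a) = t%:C *: star a.
Proof. by rewrite starZ [X in X *: _](conjc_real t). Qed.

Lemma starZi a : star ('i%C *: a) = - ('i%C *: star a).
Proof.
rewrite starZ -scaleNr; congr (_ *: _).
by apply/eqP; rewrite eq_complex/= oppr0 !eqxx.
Qed.

Lemma star_scalar t : star (t%:C%:A : A) = t%:C%:A.
Proof. by rewrite starZ_real star1. Qed.

Lemma cnorm_star a : cnorm (star a) = cnorm a.
Proof.
suff le b : cnorm b <= cnorm (star b) by apply/le_anti; rewrite le -{2}(starK a) le.
have [->|b0] := eqVneq (cnorm b) 0; first exact: cnorm_ge0.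
have bgt0 : 0 < cnorm b by rewrite lt_def b0 cnorm_ge0.
by rewrite -(ler_pM2r bgt0) -expr2 -cnorm_starM ler_cnormM.
Qed.

Lemma cnorm1 : cnorm (1 : A) = 1.
Proof.
have n0 : cnorm (1 : A) != 0.
  by apply/eqP => /cnorm0_eq0/eqP; rewrite oner_eq0.
by apply: (mulIf n0); rewrite mul1r -expr2 -cnorm_starM star1 mulr1.
Qed.

Lemma cnorm_scalar t : cnorm (t%:C%:A : A) = `|t|.
Proof. by rewrite cnormZ_real cnorm1 mulr1. Qed.

Lemma cnorm_sqr a : star a = a -> cnorm (a * a) = cnorm a ^+ 2.
Proof. by move=> sa; rewrite -cnorm_starM sa. Qed.

(** * Limits in norm *)

Definition norm_lim u l := cnorm (u n - l) @[n --> \oo] --> (0 : R).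

Lemma norm_lim_squeeze u l (s : nat -> R) :
  (forall n, cnorm (u n - l) <= s n) -> s @ \oo --> (0 : R) -> norm_lim u l.
Proof.
move=> us s0; apply: (squeeze_cvgr _ (cvg_cst 0) s0).
by apply: nearW => n; rewrite cnorm_ge0 us.
Qed.

Lemma norm_lim_unique u l m : norm_lim u l -> norm_lim u m -> l = m.
Proof.
move=> ul um; apply/eqP; rewrite -subr_eq0; apply/eqP/cnorm0_eq0.
apply/le_anti; rewrite cnorm_ge0 andbT.
have lm0 : cnorm (u n - l) + cnorm (u n - m) @[n --> \oo] --> (0 : R).
  by rewrite -[X in _ --> X](addr0 0); exact: cvgD.
apply: (cvgr_to_ge lm0); apply: nearW => n; rewrite /= (cnormBC (u n) l).
exact: ler_cnorm_dist.
Qed.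

Lemma norm_lim_cst l : norm_lim (fun=> l) l.
Proof. by rewrite /norm_lim subrr cnorm0; exact: cvg_cst. Qed.

Lemma norm_lim_shift u l : norm_lim u l -> norm_lim (fun n => u n.+1) l.
Proof. by move=> ul; rewrite /norm_lim (cvg_shiftS (fun n => cnorm (u n - l))). Qed.

Lemma norm_limD u v l m :
  norm_lim u l -> norm_lim v m -> norm_lim (fun n => u n + v n) (l + m).
Proof.
move=> ul vm; apply: (@norm_lim_squeeze _ _ (fun n => cnorm (u n - l) + cnorm (v n - m))).
  by move=> n; rewrite opprD addrACA ler_cnormD.
by rewrite -[X in _ --> X](addr0 0); exact: cvgD.
Qed.

Lemma norm_limZ k u l : norm_lim u l -> norm_lim (fun n => k *: u n) (k *: l).
Proof.
have [c ck] : exists c : R, forall a, cnorm (k *: a) = c * cnorm a.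
  exists (complex.Re `|k|) => a.
  by apply: complexI; rewrite cnormZ rmorphM normc_def.
move=> ul; apply: (@norm_lim_squeeze _ _ (fun n => c * cnorm (u n - l))).
  by move=> n; rewrite -scalerBr ck.
by rewrite -[X in _ --> X](mulr0 c); apply: cvgM => //; exact: cvg_cst.
Qed.

Lemma norm_limB u v l m :
  norm_lim u l -> norm_lim v m -> norm_lim (fun n => u n - v n) (l - m).
Proof.
move=> ul vm; rewrite -scaleN1r.
under eq_fun do rewrite -scaleN1r.
by apply: norm_limD => //; exact: norm_limZ.
Qed.

Lemma norm_lim_star u l : norm_lim u l -> norm_lim (fun n => star (u n)) (star l).
Proof.
move=> ul; apply: (@norm_lim_squeeze _ _ (fun n => cnorm (u n - l))) => // n.
by rewrite -starB cnorm_star.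
Qed.

Lemma norm_limM u v l m :
  norm_lim u l -> norm_lim v m -> norm_lim (fun n => u n * v n) (l * m).
Proof.
move=> ul vm.
pose s n := cnorm (u n - l) * (cnorm (v n - m) + cnorm m) + cnorm l * cnorm (v n - m).
apply: (@norm_lim_squeeze _ _ s) => [n|].
  have -> : u n * v n - l * m = (u n - l) * ((v n - m) + m) + l * (v n - m).
    by rewrite subrK mulrBl mulrBr addrA subrK.
  apply: (le_trans (ler_cnormD _ _)); apply: lerD; last exact: ler_cnormM.
  apply: (le_trans (ler_cnormM _ _)); apply: ler_wpM2l; first exact: cnorm_ge0.
  exact: ler_cnormD.
rewrite -[X in _ --> X](_ : 0 * (0 + cnorm m) + cnorm l * 0 = 0); last first.
  by rewrite mul0r mulr0 addr0.
apply: cvgD; apply: cvgM => //; [apply: cvgD => //|]; exact: cvg_cst.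
Qed.

Lemma cnorm_lim u l t : (forall n, cnorm (u n) <= t) -> norm_lim u l -> cnorm l <= t.
Proof.
move=> ut ul; rewrite -[t]add0r -lerBlDr.
apply: (cvgr_to_ge ul); apply: nearW => n; have := ut n.
by have := ler_cnorm_dist (u n) l 0; rewrite !subr0 cnormBC; lra.
Qed.

Lemma cauchy_norm_lim u :
  (forall e : R, 0 < e -> exists N : nat, forall m n : nat,
    (N <= m)%N -> (N <= n)%N -> cnorm (u m - u n) < e) ->
  exists l, norm_lim u l.
Proof.
move=> /cnorm_complete[l ul]; exists l; apply/cvgr0Pnorm_lt => e /ul[N uN].
by exists N => // n /= /uN; rewrite ger0_norm ?cnorm_ge0.
Qed.

(** A sequence whose steps are dominated by those of a bounded increasing real
sequence is Cauchy. Square roots, inverses and quotients are obtained as limits of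
this kind. *)
Lemma majorized_norm_lim u (s : nat -> R) M :
  (forall n, cnorm (u n.+1 - u n) <= s n.+1 - s n) -> (forall n, s n <= M) ->
  exists l, norm_lim u l.
Proof.
move=> us sM.
have s_nd : nondecreasing_seq s.
  apply/nondecreasing_seqP => n; rewrite -subr_ge0.
  exact: le_trans (cnorm_ge0 _) (us n).
have dist n k : cnorm (u (n + k)%N - u n) <= s (n + k)%N - s n.
  elim: k => [|k IH]; first by rewrite addn0 !subrr cnorm0.
  apply: (le_trans (ler_cnorm_dist (u (n + k)%N) _ _)); rewrite addnS.
  by have := us (n + k)%N; lra.
have s_cvg : cvgn s.
  by apply: nondecreasing_is_cvgn => //; exists M => _ [n _ <-].
pose l := limn s.
have s_le n : s n <= l.
  exact: nondecreasing_cvgn_le.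
apply: cauchy_norm_lim => e e0.
have /cvgrPdist_lt/(_ _ e0)[N _ sN] : s @ \oo --> l by [].
have lt_e m n : (N <= m)%N -> (m <= n)%N -> cnorm (u n - u m) < e.
  move=> Nm /subnKC <-; apply: (le_lt_trans (dist _ _)).
  have := sN m Nm; rewrite ger0_norm ?subr_ge0//; have := s_le (m + (n - m))%N; lra.
exists N => m n Nm Nn; have [mn|/ltnW nm] := leqP m n; last exact: lt_e.
by rewrite cnormBC; exact: lt_e.
Qed.

End CStarBasics.

(** * Square roots *)

Section SquareRoot.
Variables (R : realType) (A : cstarAlgType R).
Implicit Types (p q a : A) (t : R).

Definition sqrt_step d (x : A) : A := (2^-1)%:C *: (d + x * x).

Definition sqrt_iter d n : A := iter n (sqrt_step d) 0.

Definition sqrt_majorant n : R := iter n (fun s => 2^-1 * (1 + s ^+ 2)) 0.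

Lemma sqrt_majorant_bound n : 0 <= sqrt_majorant n <= 1.
Proof. by elim: n => [|n /andP[]] /=; rewrite -/(sqrt_majorant _); nra. Qed.

Lemma sqrt_iter_comm d a n : a * d = d * a -> a * sqrt_iter d n = sqrt_iter d n * a.
Proof.
move=> ad; elim: n => [|n IH] /=; first by rewrite mulr0 mul0r.
rewrite -/(sqrt_iter _ _) -scalerAr -scalerAl mulrDr mulrDl ad.
by rewrite mulrA IH -mulrA IH mulrA.
Qed.

Lemma sqrt_iter_star d n : star d = d -> star (sqrt_iter d n) = sqrt_iter d n.
Proof.
move=> sd; elim: n => [|n IH] /=; first exact: star0.
by rewrite -/(sqrt_iter _ _) starZ_real starD starM sd IH.
Qed.

Lemma cnorm_sqrt_iter d n : cnorm d <= 1 -> cnorm (sqrt_iter d n) <= sqrt_majorant n.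
Proof.
move=> d1; elim: n => [|n IH] /=; first by rewrite cnorm0.
rewrite -/(sqrt_iter _ _) -/(sqrt_majorant _) cnormZ_real ger0_norm ?invr_ge0//.
apply: ler_wpM2l; first by rewrite invr_ge0.
apply: (le_trans (ler_cnormD _ _)); apply: lerD => //.
apply: (le_trans (ler_cnormM _ _)); rewrite expr2.
by apply: ler_pM => //; exact: cnorm_ge0.
Qed.

(** The iterates commute with each other, so that the difference of two
consecutive squares factors and the scalar recursion dominates. *)
Lemma cnorm_sqrt_iter_step d n : cnorm d <= 1 ->
  cnorm (sqrt_iter d n.+1 - sqrt_iter d n) <= sqrt_majorant n.+1 - sqrt_majorant n.
Proof.
move=> d1; elim: n => [|n IH].
  rewrite /= !subr0 /sqrt_step mul0r addr0 cnormZ_real ger0_norm ?invr_ge0//.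
  by have := cnorm_ge0 d; nra.
set x := sqrt_iter d n in IH *; set y := sqrt_iter d n.+1 in IH *.
have xy : y * x = x * y.
  have xd : x * d = d * x by apply/esym/sqrt_iter_comm.
  exact/esym/(sqrt_iter_comm n.+1).
have -> : sqrt_iter d n.+2 - y = (2^-1)%:C *: ((y - x) * (y + x)).
  rewrite -/(sqrt_step d y) {2}(erefl : y = sqrt_step d x) -scalerBr; congr (_ *: _).
  by rewrite opprD addrACA subrr add0r mulrBl !mulrDr xy opprD addrA addrK.
rewrite cnormZ_real ger0_norm ?invr_ge0//.
have nx : cnorm x <= sqrt_majorant n by exact: cnorm_sqrt_iter.
have ny : cnorm y <= sqrt_majorant n.+1 by exact: cnorm_sqrt_iter.
have -> : sqrt_majorant n.+2 - sqrt_majorant n.+1 =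
    2^-1 * ((sqrt_majorant n.+1 - sqrt_majorant n) *
            (sqrt_majorant n.+1 + sqrt_majorant n)).
  have majS k : sqrt_majorant k.+1 = 2^-1 * (1 + sqrt_majorant k ^+ 2) by [].
  by rewrite majS {2}majS; ring.
apply: ler_wpM2l; first by rewrite invr_ge0.
apply: (le_trans (ler_cnormM _ _)); apply: ler_pM; rewrite ?cnorm_ge0//.
by apply: (le_trans (ler_cnormD _ _)); exact: lerD.
Qed.

(** Writing [p = 1 - d] and [q = 1 - x], the equation [q * q = p] reads
[x = (d + x * x) / 2], which is solved by iteration from [0]. *)
Lemma sqrt_unit_ball p : star p = p -> cnorm (1 - p) <= 1 ->
  exists q, [/\ star q = q, cnorm (1 - q) <= 1, q * q = p &
    forall a, a * p = p * a -> a * q = q * a].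
Proof.
move=> sp p1; set d : A := 1 - p.
have sd : star d = d by rewrite starB star1 sp.
have [x xl] : exists x, norm_lim (sqrt_iter d) x.
  apply: (@majorized_norm_lim _ _ _ sqrt_majorant 1) => n.
    exact: cnorm_sqrt_iter_step.
  by case/andP: (sqrt_majorant_bound n).
have x_fix : x = sqrt_step d x.
  apply: (norm_lim_unique (norm_lim_shift xl)).
  exact: (norm_limZ (2^-1)%:C (norm_limD (norm_lim_cst d) (norm_limM xl xl))).
exists (1 - x); split.
- rewrite starB star1; congr (_ - _).
  apply: norm_lim_unique (xl); have := norm_lim_star xl.
  by under eq_fun do rewrite sqrt_iter_star//.
- rewrite opprB addrC subrK; apply: (cnorm_lim _ xl) => n.
  by apply: (le_trans (cnorm_sqrt_iter n p1)); case/andP: (sqrt_majorant_bound n).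
- have x2 : x * x = x + x - d.
    rewrite {3 4}x_fix -scalerDl -rmorphD/= [2^-1 + _](_ : _ = 1) ?scale1r//.
      by rewrite addrC addKr.
    by field.
  rewrite mulrBl mul1r mulrBr mulr1 opprB x2 [x + x - d - x]addrAC addrK.
  by rewrite addrA subrK /d opprB addrC subrK.
- move=> a ap; rewrite mulrBr mulrBl mulr1 mul1r; congr (_ - _).
  apply: (norm_lim_unique (norm_limM (norm_lim_cst a) xl)).
  have ad : a * d = d * a by rewrite mulrBr mulrBl mulr1 mul1r ap.
  under eq_fun do rewrite (sqrt_iter_comm _ ad).
  exact: norm_limM xl (norm_lim_cst a).
Qed.

(** The positive elements of a C*-algebra: a self-adjoint element has
nonnegative spectrum exactly when it lies in some ball of radius [t] around the
scalar [t]. This form needs no spectral theory. *)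
Definition positive p := star p = p /\ exists t, cnorm (t%:C%:A - p) <= t.

Lemma positive_sqrt p : positive p ->
  exists q, [/\ positive q, q * q = p & forall a, a * p = p * a -> a * q = q * a].
Proof.
move=> [sp [t pt]].
have t_ge0 : 0 <= t := le_trans (cnorm_ge0 _) pt.
have [t0|tN0] := eqVneq t 0.
  have p0 : p = 0.
    apply: cnorm0_eq0; apply/le_anti; rewrite cnorm_ge0 andbT.
    by move: pt; rewrite t0 scale0r sub0r cnormN.
  exists 0; split; [|by rewrite p0 mulr0|by move=> a _; rewrite mulr0 mul0r].
  by split; [exact: star0|exists 0; rewrite scale0r subr0 cnorm0].
have t_gt0 : 0 < t by rewrite lt_def tN0.
have tCV : t%:C * t^-1%:C = 1 :> R[i] by rewrite -rmorphM/= mulfV.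
have p_rescale : t%:C *: (t^-1%:C *: p) = p by rewrite scalerA tCV scale1r.
have [||q [sq q1 qq qc]] := @sqrt_unit_ball (t^-1%:C *: p).
- by rewrite starZ_real sp.
- rewrite -(ler_pM2l t_gt0) -{1}(ger0_norm t_ge0) -cnormZ_real.
  by rewrite scalerBr p_rescale mulr1.
pose r := Num.sqrt t.
exists (r%:C *: q); split.
- split; first by rewrite starZ_real sq.
  exists r; rewrite -scalerBr cnormZ_real ger0_norm ?sqrtr_ge0//.
  by rewrite ler_piMr// sqrtr_ge0.
- rewrite -scalerAl -scalerAr scalerA -rmorphM/= -expr2 sqr_sqrtr//.
  by rewrite qq p_rescale.
- move=> a ap; rewrite -scalerAl -scalerAr; congr (_ *: _); apply: qc.
  by rewrite -scalerAl -scalerAr ap.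
Qed.

(** The element [u = a + i b] satisfies [star u * u = t], so its norm is [sqrt t],
and [a] is its real part. *)
Lemma cnorm_le_of_sqr_sum a b t : star a = a -> star b = b -> a * b = b * a ->
  0 <= t -> a * a + b * b = t%:C%:A -> cnorm a ^+ 2 <= t.
Proof.
move=> sa sb ab t0 abt; pose u := a + 'i%C *: b.
have su : star u = a - 'i%C *: b by rewrite starD starZi sa sb.
have uu : star u * u = t%:C%:A.
  have ii : 'i%C * 'i%C = -1 :> R[i] by rewrite -expr2 sqr_i.
  rewrite su mulrBl !mulrDr -!scalerAl -!scalerAr scalerA ii.
  by rewrite scaleN1r ab -abt opprD opprK addrA addrK.
have nu : cnorm u ^+ 2 = t by rewrite -cnorm_starM uu cnorm_scalar ger0_norm.
have a2 : 2%:R%:C *: a = u + star u.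
  by rewrite su addrACA subrr addr0 rmorph_nat scaler_nat mulr2n.
have : 2 * cnorm a <= cnorm u + cnorm u.
  rewrite -{2}(cnorm_star u); apply: le_trans (ler_cnormD _ _).
  by rewrite -a2 cnormZ_real ger0_norm.
have := cnorm_ge0 a; rewrite -nu; nra.
Qed.

(** Every self-adjoint [a] is thus the real part of a multiple of a unitary: the
square root of [t - a * a] commutes with [a]. *)
Lemma sqr_complement a t : star a = a -> cnorm a ^+ 2 <= t ->
  exists b, [/\ star b = b, a * b = b * a & a * a + b * b = t%:C%:A].
Proof.
move=> sa at_; have [|b [[sb _] bb bc]] := @positive_sqrt (t%:C%:A - a * a).
  split; first by rewrite starB star_scalar starM sa.
  by exists t; rewrite opprB addrC subrK cnorm_sqr.
exists b; split=> //; last by rewrite bb addrC subrK.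
by apply: bc; rewrite mulrBr mulrBl -scalerAr -scalerAl mulr1 mul1r mulrA.
Qed.

(** With [t] the squared norm of [a] and [a * a + b * b = t], the distance from
[a * a] to [t] is the norm of [b * b], and [b] is a real part too. *)
Lemma positive_sqr a : star a = a -> positive (a * a).
Proof.
move=> sa; split; first by rewrite starM sa.
exists (cnorm a ^+ 2).
have [b [sb ab abt]] := sqr_complement sa (lexx _).
rewrite -abt addrC addKr cnorm_sqr//.
apply: (@cnorm_le_of_sqr_sum b a) => //; first exact: sqr_ge0.
by rewrite addrC.
Qed.

Lemma positiveD p q : positive p -> positive q -> positive (p + q).
Proof.
move=> [sp [s ps]] [sq [t qt]]; split; first by rewrite starD sp sq.
exists (s + t); rewrite rmorphD/= scalerDl opprD addrACA.
by apply: le_trans (ler_cnormD _ _) _; exact: lerD.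
Qed.

End SquareRoot.

Section StarAutomorphism.
Variables (R : realType) (A : cstarAlgType R) (phi : A -> A).
Hypothesis phi_aut : star_automorphism (O := cstar_ops A) phi.

Let phiD a b : phi (a + b) = phi a + phi b.
Proof. by have [_ h _ _ _] := phi_aut; exact: h. Qed.

Let phiM a b : phi (a * b) = phi a * phi b.
Proof. by have [_ _ h _ _] := phi_aut; exact: h. Qed.

Let phiZ (k : R[i]) a : phi (k *: a) = k *: phi a.
Proof. by have [_ _ _ h _] := phi_aut; exact: h. Qed.

Let phi_star a : phi (star a) = star (phi a).
Proof. by have [_ _ _ _ h] := phi_aut; exact: h. Qed.

Lemma star_automorphism1 : phi 1 = 1.
Proof.
have [[psi phiK psiK] _ _ _ _] := phi_aut.
by rewrite -[LHS]mul1r -[X in X * _]psiK -phiM mulr1 psiK.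
Qed.

Lemma star_automorphismB a b : phi (a - b) = phi a - phi b.
Proof. by rewrite phiD -(scaleN1r b) phiZ scaleN1r. Qed.

(** Automatic continuity: up to a scalar, a self-adjoint [a] is the real part of
a unitary, and so is its image, because [phi] transports the equation
[a * a + b * b = t]. *)
Lemma cnorm_star_automorphism a : cnorm (phi a) <= cnorm a.
Proof.
have self_adjoint b : star b = b -> cnorm (phi b) <= cnorm b.
  move=> sb; have [c [sc bc bct]] := sqr_complement sb (lexx _).
  rewrite -(ler_pXn2r (n := 2)) ?nnegrE ?cnorm_ge0//.
  apply: (@cnorm_le_of_sqr_sum _ _ (phi b) (phi c)); rewrite ?sqr_ge0//.
  - by rewrite -phi_star sb.
  - by rewrite -phi_star sc.
  - by rewrite -!phiM bc.
  - by rewrite -!phiM -phiD bct phiZ star_automorphism1.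
rewrite -(ler_pXn2r (n := 2)) ?nnegrE ?cnorm_ge0//.
rewrite -!cnorm_starM -phi_star -phiM; apply: self_adjoint.
by rewrite starM starK.
Qed.

End StarAutomorphism.

(** * Factorization in commutative C*-algebras *)

#[short(type="comCStarAlgType")]
HB.structure Definition ComCStarAlgebra (R : realType) :=
  {C of GRing.ComAlgebra R[i] C & isCStarAlgebra R C}.

Section Commutative.
Variables (R : realType) (C : comCStarAlgType R).
Implicit Types (f g h p q : C) (t e : R).

Local Notation "t %:S" := (in_alg C t%:C) (at level 2, format "t %:S").

Lemma positive_scalar t : 0 <= t -> positive (t%:S : C).
Proof.
move=> t0; split; first exact: star_scalar.
by exists t; rewrite subrr cnorm0.
Qed.

Lemma positiveM p q : positive p -> positive q -> positive (p * q).
Proof.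
move=> /positive_sqrt[r [[sr _] <- _]] /positive_sqrt[s [[ss _] <- _]].
rewrite mulrACA; apply: positive_sqr.
by rewrite starM sr ss mulrC.
Qed.

(** With [f = a + i b], [a] and [b] self-adjoint, this is [a * a + b * b]. *)
Lemma positive_star_mul f : positive (star f * f).
Proof.
pose i := in_alg C 'i%C.
have i2 : i * i = -1 by rewrite -rmorphM/= -expr2 sqr_i scaleN1r.
pose a := (2^-1)%:S * (f + star f).
pose b := (2^-1)%:S * (i * (star f - f)).
have -> : star f * f = a * a + b * b.
  rewrite /a /b.
  have -> : (2^-1)%:S * (i * (star f - f)) * ((2^-1)%:S * (i * (star f - f))) =
      - ((2^-1)%:S * (star f - f) * ((2^-1)%:S * (star f - f))).
    by rewrite -[RHS]mulN1r -i2; ring.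
  have h2 : 2%:R * (2^-1)%:S = 1 :> C.
    by rewrite -(rmorph_nat (in_alg C \o real_complex R)) -!rmorphM/= mulfV ?rmorph1// scale1r.
  transitivity ((2%:R * (2^-1)%:S) * (2%:R * (2^-1)%:S) * (star f * f)).
    by rewrite h2 !mul1r.
  by ring.
apply: positiveD; apply: positive_sqr; rewrite /a /b !mulr_algl starZ_real.
  by rewrite starD starK addrC.
by rewrite starZi starB starK -scalerN opprB.
Qed.

(** Monotonicity: with [t] the norm of [p + q], the element [t - p] is the sum of
[t - (p + q)] and [q], hence a square, and [p] itself is a square, so that
[cnorm_le_of_sqr_sum] applies. *)
Lemma cnorm_positive_le p q : positive p -> positive q -> cnorm p <= cnorm (p + q).
Proof.
move=> pp pq; set t := cnorm (p + q).
have [spq _] := positiveD pp pq.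
have ptpq : positive (t%:S - (p + q)).
  split; first by rewrite starB star_scalar spq.
  by exists t; rewrite opprB addrC subrK.
have [s [[ss _] s2 _]] := positive_sqrt (positiveD ptpq pq).
have [r [[sr _] r2 _]] := positive_sqrt pp.
rewrite -r2 cnorm_sqr//; apply: (@cnorm_le_of_sqr_sum _ _ r s) => //.
- exact: mulrC.
- exact: cnorm_ge0.
- by rewrite r2 s2 in_algE; ring.
Qed.

(** The inverse is the limit of the Neumann iteration [y |-> 1 + (1 - f) * y]. *)
Lemma invertible_of_dist f : cnorm (1 - f) < 1 -> exists g, f * g = 1.
Proof.
set d := 1 - f => d1.
pose step (y : C) := 1 + d * y.
pose y n := iter n step 0.
pose c := cnorm d.
have c0 : 0 <= c by exact: cnorm_ge0.
have yS n : cnorm (y n.+1 - y n) <= c ^+ n.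
  elim: n => [|n IH]; first by rewrite /y/= /step mulr0 addr0 subr0 cnorm1.
  have -> : y n.+2 - y n.+1 = d * (y n.+1 - y n).
    by rewrite /y !iterS /step; ring.
  by rewrite exprS; apply: (le_trans (ler_cnormM _ _)); rewrite ler_wpM2l.
pose s n := (1 - c ^+ n) / (1 - c).
have c1 : 0 < 1 - c by rewrite subr_gt0.
have [g yg] : exists g, norm_lim y g.
  apply: (@majorized_norm_lim _ _ _ s (1 - c)^-1) => n.
    apply: le_trans (yS n) _; rewrite /s -mulrBl.
    rewrite [_ - _](_ : _ = c ^+ n * (1 - c)); last by rewrite exprS; ring.
    by rewrite mulfK// gt_eqF.
  by rewrite /s ler_pdivrMr// mulVf ?gt_eqF// lerBlDr lerDl exprn_ge0.
exists g.
have g_fix : g = 1 + d * g.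
  apply: (norm_lim_unique (norm_lim_shift yg)).
  exact: (norm_limD (norm_lim_cst 1) (norm_limM (norm_lim_cst d) yg)).
have -> : f = 1 - d by rewrite /d; ring.
by rewrite mulrBl mul1r {1}g_fix addrK.
Qed.

(** A small multiple of [h + e] is close to [1], hence invertible; the inverse [r]
is positive because [r = r * r * (h + e)]. *)
Lemma positive_inverse h e : positive h -> 0 < e ->
  exists r, positive r /\ (h + e%:S) * r = 1.
Proof.
move=> ph e0; have [sh [t ht]] := ph.
have t0 : 0 <= t := le_trans (cnorm_ge0 _) ht.
have te0 : 0 < t + e by lra.
have [|g hg] := @invertible_of_dist (((t + e)^-1)%:S * (h + e%:S)).
  have te1 : (t + e)%:S * ((t + e)^-1)%:S = 1 :> C.
    by rewrite -!rmorphM/= mulfV ?gt_eqF// rmorph1 scale1r.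
  rewrite -(ltr_pM2l te0) -{1}(ger0_norm (ltW te0)) -cnormZ_real -mulr_algl mulr1.
  apply: (@le_lt_trans _ _ t); last by lra.
  rewrite -in_algE mulrBr mulr1 mulrA te1 mul1r.
  have -> : (t + e)%:S - (h + e%:S) = t%:S - h by ring.
  by rewrite in_algE.
pose r := ((t + e)^-1)%:S * g.
have hr : (h + e%:S) * r = 1 by rewrite -hg /r; ring.
exists r; split=> //.
have sr : star r = r.
  have srh : star r * (h + e%:S) = 1.
    have <- : star (h + e%:S) = h + e%:S by rewrite starD star_scalar sh.
    by rewrite -starM hr star1.
  by rewrite -[LHS]mulr1 -hr mulrA srh mul1r.
have -> : r = r * r * h + r * r * e%:S.
  by rewrite -[LHS]mulr1 -hr; ring.
by apply: positiveD; apply: positiveM => //; [exact: positive_sqr..|exact/positive_scalar/ltW].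
Qed.

(** If [|f|^2 <= h^4] then [f / h] extends continuously by [0] over the zeros of
[h], as the limit of [f / (h + e)] when [e] tends to [0]: in absolute value
[f / (h + e) - f / (h + e')] is at most [|e - e'|] times
[(h / (h + e)) * (h / (h + e'))], hence at most [|e - e'|]. *)
Lemma factor_of_le f g h : positive h -> positive g ->
  h ^+ 4 = star f * f + g -> exists k, f = h * k.
Proof.
move=> ph pg hfg.
have /choice[r rP] (n : nat) : exists r, positive r /\ (h + (n.+1%:R^-1)%:S) * r = 1.
  by apply: positive_inverse => //; rewrite invr_gt0.
pose e n : R := n.+1%:R^-1.
have pr n : positive (r n) by case: (rP n).
have hr n : (h + (e n)%:S) * r n = 1 by case: (rP n).
have hr1 n : cnorm (h * r n) <= 1.
  rewrite -(cnorm1 C) -(hr n) mulrDl; apply: cnorm_positive_le; apply: positiveM => //.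
  by apply: positive_scalar; rewrite invr_ge0.
have fr1 m n : cnorm (f * (r m * r n)) <= 1.
  rewrite -(ler_pXn2r (n := 2)) ?nnegrE ?cnorm_ge0// expr1n -cnorm_starM starM.
  have [srr _] := positiveM (pr m) (pr n).
  have prr := positiveM (positiveM (pr m) (pr n)) (positiveM (pr m) (pr n)).
  have -> : star (r m * r n) * star f * (f * (r m * r n)) =
    star f * f * (r m * r n * (r m * r n)) by rewrite srr; ring.
  apply: (le_trans (cnorm_positive_le (positiveM (positive_star_mul f) prr)
    (positiveM pg prr))).
  have -> : star f * f * (r m * r n * (r m * r n)) + g * (r m * r n * (r m * r n)) =
    (h * r m) * (h * r m) * ((h * r n) * (h * r n)) by rewrite -mulrDl -hfg; ring.
  rewrite -[1]mulr1.
  apply: (le_trans (ler_cnormM _ _)); apply: ler_pM; rewrite ?cnorm_ge0// -[1]mulr1;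
    by apply: (le_trans (ler_cnormM _ _)); apply: ler_pM; rewrite ?cnorm_ge0.
have e_dec n : e n.+1 <= e n by rewrite lef_pV2 ?posrE// ler_nat.
have [k yk] : exists k, norm_lim (fun n => f * r n) k.
  apply: (@majorized_norm_lim _ _ _ (fun n => - e n) 0) => n; last first.
    by rewrite oppr_le0 invr_ge0.
  have -> : f * r n.+1 - f * r n = (e n - e n.+1)%:S * (f * (r n * r n.+1)).
    transitivity (f * (r n.+1 * ((h + (e n)%:S) * r n) - r n * ((h + (e n.+1)%:S) * r n.+1))).
      by rewrite !hr; ring.
    by ring.
  rewrite mulr_algl cnormZ_real ger0_norm ?subr_ge0// opprK [leRHS]addrC.
  by rewrite ler_piMr// subr_ge0.
exists k.
have e_lim : norm_lim (fun n => (e n)%:S) 0.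
  apply: (norm_lim_squeeze _ (@cvg_harmonic R)) => n.
  by rewrite subr0 cnorm_scalar ger0_norm// invr_ge0.
have : norm_lim (fun n => f - (e n)%:S * (f * r n)) (f - 0 * k).
  by apply: norm_limB; [exact: norm_lim_cst|exact: norm_limM].
rewrite mul0r subr0 => f_lim; apply: (norm_lim_unique f_lim).
rewrite [X in norm_lim X](_ : _ = fun n => h * (f * r n)).
  exact: norm_limM (norm_lim_cst h) yk.
by apply/funext => n; rewrite -[X in X - _]mulr1 -(hr n); ring.
Qed.

(** The element [h] vanishes at every common zero of [f] and [g], by the equation
for [h ^+ 4]. A square root of the right-hand side would not do: the quotient of
[f] by it is bounded but need not extend continuously. *)
Lemma common_factor f g : exists h, [/\ star h = h,
  h ^+ 4 = star f * f + star g * g, exists k, f = h * k & exists k, g = h * k].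
Proof.
have pf := positive_star_mul f; have pg := positive_star_mul g.
have [q [pq q2 _]] := positive_sqrt (positiveD pf pg).
have [h [ph h2 _]] := positive_sqrt pq.
have h4 : h ^+ 4 = star f * f + star g * g by rewrite -q2 -h2; ring.
exists h; split=> //; first by case: ph.
- exact: factor_of_le h4.
- by apply: (factor_of_le ph pf); rewrite addrC.
Qed.

End Commutative.

(** * The centre fixed by the action *)

Section InvariantCentreCStar.
Variables (R : realType) (G : topologicalGroupType) (A : cstarAlgType R).
Variable alpha : cstar_action G A.
Implicit Types (z : invariant_centre alpha).

Let alpha_aut g : star_automorphism (O := cstar_ops A) (alpha g) :=
  act_aut (cstar_actP alpha) g.

Lemma central_val z a : \val z * a = a * \val z.
Proof. by have /invariant_centreP[+ _] := valP z; apply. Qed.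

Lemma invariant_val z g : alpha g (\val z) = \val z.
Proof. by have /invariant_centreP[_] := valP z; apply. Qed.

Lemma star_invariant_centre z : star (\val z) \in in_invariant_centre alpha.
Proof.
apply/invariant_centreP; split=> [a|g].
  by rewrite -[a in LHS]starK -starM -central_val starM starK.
by have [_ _ _ _ ->] := alpha_aut g; rewrite invariant_val.
Qed.

(** The fixed points of [alpha g] are closed because [alpha g] is contractive. *)
Lemma norm_lim_invariant_centre (u : nat -> A) l :
  (forall n, u n \in in_invariant_centre alpha) -> norm_lim u l ->
  l \in in_invariant_centre alpha.
Proof.
move=> uC ul; apply/invariant_centreP; split=> [a|g].
  apply: (norm_lim_unique (norm_limM ul (norm_lim_cst a))).
  rewrite [X in norm_lim X](_ : _ = fun n => a * u n).
    exact: norm_limM (norm_lim_cst a) ul.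
  by apply/funext => n; have /invariant_centreP[+ _] := uC n; apply.
apply: norm_lim_unique (ul); apply: (norm_lim_squeeze _ ul) => n.
have /invariant_centreP[_ /(_ g) ug] := uC n; rewrite -{1}ug.
rewrite -(star_automorphismB (alpha_aut g)).
exact: (cnorm_star_automorphism (alpha_aut g)).
Qed.

Let C := invariant_centre alpha.

Definition centre_star z : C := InvariantCentre (star_invariant_centre z).
Definition centre_norm z : R := cnorm (\val z).

Lemma centre_starD : {morph centre_star : y z / y + z}.
Proof. by move=> y z; apply: val_inj; exact: starD. Qed.

Lemma centre_starZ (k : R[i]) z : centre_star (k *: z) = k^* *: centre_star z.
Proof. by apply: val_inj; exact: starZ. Qed.

Lemma centre_starM y z : centre_star (y * z) = centre_star z * centre_star y.
Proof. by apply: val_inj; exact: starM. Qed.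

Lemma centre_starK : involutive centre_star.
Proof. by move=> z; apply: val_inj; exact: starK. Qed.

Lemma centre_norm0_eq0 z : centre_norm z = 0 -> z = 0.
Proof. by move=> z0; apply: val_inj; exact: cnorm0_eq0. Qed.

Lemma centre_normZ (k : R[i]) z : (centre_norm (k *: z))%:C = `|k| * (centre_norm z)%:C.
Proof. exact: cnormZ. Qed.

Lemma ler_centre_normD y z : centre_norm (y + z) <= centre_norm y + centre_norm z.
Proof. exact: ler_cnormD. Qed.

Lemma ler_centre_normM y z : centre_norm (y * z) <= centre_norm y * centre_norm z.
Proof. exact: ler_cnormM. Qed.

Lemma centre_norm_starM z : centre_norm (centre_star z * z) = centre_norm z ^+ 2.
Proof. exact: cnorm_starM. Qed.

Lemma centre_complete (u : nat -> C) :
  (forall e : R, 0 < e -> exists N : nat, forall m n : nat,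
    (N <= m)%N -> (N <= n)%N -> centre_norm (u m - u n) < e) ->
  exists l : C, forall e : R, 0 < e -> exists N : nat, forall n : nat,
    (N <= n)%N -> centre_norm (u n - l) < e.
Proof.
move=> u_cauchy; have [l ul] := @cauchy_norm_lim _ _ (fun n => \val (u n)) u_cauchy.
have lC := norm_lim_invariant_centre (fun n => valP (u n)) ul.
exists (InvariantCentre lC) => e e0.
have /cvgr0Pnorm_lt/(_ e e0)[N _ uN] := ul.
by exists N => n /uN; rewrite /= ger0_norm ?cnorm_ge0.
Qed.

HB.instance Definition _ := isCStarAlgebra.Build R (invariant_centre alpha)
  centre_starD centre_starZ centre_starM centre_starK centre_norm0_eq0
  centre_normZ ler_centre_normD ler_centre_normM centre_norm_starM centre_complete.

Lemma centre_mulC : commutative (@GRing.mul C).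
Proof. by move=> y z; apply: val_inj; exact: central_val. Qed.

HB.instance Definition _ :=
  GRing.PzSemiRing_hasCommutativeMul.Build (invariant_centre alpha) centre_mulC.

End InvariantCentreCStar.

(** * Quotients by ideals *)

Section QuotientOps.
Variables (R : realType) (A : cstarAlgType R).

Record star_ideal (J : set A) : Prop := StarIdeal {
  star_ideal0 : J 0 ;
  star_idealB : forall a b, J a -> J b -> J (a - b) ;
  star_idealMl : forall a b, J b -> J (a * b) ;
  star_idealMr : forall a b, J a -> J (a * b) ;
  star_ideal_star : forall a, J a -> J (star a)
}.

Variables (J : set A) (J_ideal : star_ideal J).
Implicit Types (a b : A) (s t : quotient J).

Local Notation pi := (qproj J).

Lemma star_idealN a : J a -> J (- a).
Proof. by rewrite -sub0r; apply: star_idealB => //; exact: star_ideal0. Qed.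

Lemma star_idealD a b : J a -> J b -> J (a + b).
Proof. by move=> Ja /star_idealN Jb; rewrite -[b]opprK; exact: star_idealB. Qed.

Lemma star_idealZ (k : R[i]) a : J a -> J (k *: a).
Proof. by rewrite -mulr_algl; exact: star_idealMl. Qed.

Lemma qprojP a b : pi a = pi b <-> J (a - b).
Proof.
split=> [ab|Jab].
  have : coset_mod J a a by exists 0; [exact: star_ideal0|rewrite addr0].
  have -> : coset_mod J a = coset_mod J b := congr1 val ab.
  by move=> [j Jj <-]; rewrite addrC addKr.
apply: val_inj; apply/seteqP; split=> _ [j Jj <-].
  by exists (a - b + j); [exact: star_idealD|rewrite addrA addrC subrKC addrC].
exists (j - (a - b)); first exact: star_idealB.
by rewrite opprB addrCA [a + _]addrC subrK addrC.
Qed.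

Lemma qproj_surj s : exists a, s = pi a.
Proof.
have [a _ sa] := set_valP s; exists a.
by apply: val_inj; exact: esym.
Qed.

Lemma qrepr_qproj a : J (qrepr (pi a) - a).
Proof.
have : coset_mod J a (qrepr (pi a)).
  apply: (@xgetI _ _ _ a); exists 0; [exact: star_ideal0|exact: addr0].
by move=> [j Jj <-]; rewrite addrC addKr.
Qed.

Lemma qaddE a b : qadd (pi a) (pi b) = pi (a + b).
Proof.
by apply/qprojP; rewrite opprD addrACA; apply: star_idealD; exact: qrepr_qproj.
Qed.

Lemma qsubE a b : qsub (pi a) (pi b) = pi (a - b).
Proof.
apply/qprojP; rewrite [X in J X](_ : _ = (qrepr (pi a) - a) - (qrepr (pi b) - b)).
  by apply: star_idealB => //; exact: qrepr_qproj.
by rewrite !opprB addrACA [RHS]addrACA [- a - _]addrC.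
Qed.

Lemma qmulE a b : qmul (pi a) (pi b) = pi (a * b).
Proof.
apply/qprojP.
rewrite [X in J X](_ : _ = (qrepr (pi a) - a) * qrepr (pi b) + a * (qrepr (pi b) - b)).
  apply: star_idealD; [apply: star_idealMr|apply: star_idealMl] => //; exact: qrepr_qproj.
by rewrite mulrBl mulrBr addrA subrK.
Qed.

Lemma qscaleE (k : R[i]) a : qscale k (pi a) = pi (k *: a).
Proof. by apply/qprojP; rewrite -scalerBr; apply: star_idealZ; exact: qrepr_qproj. Qed.

Lemma qstarE a : qstar (pi a) = pi (star a).
Proof. by apply/qprojP; rewrite -starB; apply: star_ideal_star => //; exact: qrepr_qproj. Qed.

Lemma qnorm_le a j : J j -> qnorm (pi a) <= cnorm (a + j).
Proof.
move=> Jj; apply: ge_inf; last by exists (a + j) => //; exists j.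
by exists 0 => _ [b _ <-]; exact: cnorm_ge0.
Qed.

Lemma qnorm_ltP a e : qnorm (pi a) < e <-> exists2 j, J j & cnorm (a + j) < e.
Proof.
split=> [|[j Jj]]; last by apply: le_lt_trans; exact: qnorm_le.
move/inf_lt => [|_ [_ [j Jj <-] <-]]; last by exists j.
by exists (cnorm (a + 0)), (a + 0) => //; exists 0 => //; exact: star_ideal0.
Qed.

Lemma ler_qnorm_proj a : qnorm (pi a) <= cnorm a.
Proof. by rewrite -[in leRHS](addr0 a); apply: qnorm_le; exact: star_ideal0. Qed.

Lemma qnorm_ltD a b e e' : qnorm (pi a) < e -> qnorm (pi b) < e' ->
  qnorm (pi (a + b)) < e + e'.
Proof.
move=> /qnorm_ltP[j Jj aj] /qnorm_ltP[k Jk bk]; apply/qnorm_ltP.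
exists (j + k); first exact: star_idealD.
by rewrite addrACA; apply: (le_lt_trans (ler_cnormD _ _)); exact: ltrD.
Qed.

End QuotientOps.

Section QuotientAction.
Variables (R : realType) (G : topologicalGroupType) (A : cstarAlgType R).
Variables (alpha : cstar_action G A) (J : set A) (J_ideal : star_ideal J).
Hypothesis J_invariant : forall g a, J a -> J (alpha g a).

Local Notation pi := (qproj J).

Let alpha_aut g : star_automorphism (O := cstar_ops A) (alpha g) :=
  act_aut (cstar_actP alpha) g.

Definition quotient_act g (s : quotient J) : quotient J := pi (alpha g (qrepr s)).

Lemma quotient_actE g a : quotient_act g (pi a) = pi (alpha g a).
Proof.
apply/qprojP => //; rewrite -(star_automorphismB (alpha_aut g)).
by apply: J_invariant; exact: qrepr_qproj.
Qed.

Lemma quotient_act_contract g a e :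
  qnorm (pi a) < e -> qnorm (quotient_act g (pi a)) < e.
Proof.
move=> /qnorm_ltP -/(_ J_ideal)[j Jj aj]; rewrite quotient_actE.
apply/qnorm_ltP => //; exists (alpha g j); first exact: J_invariant.
have [_ aD _ _ _] := alpha_aut g.
rewrite -[_ + _](aD a j); apply: le_lt_trans aj.
exact: (cnorm_star_automorphism (alpha_aut g)).
Qed.

Lemma quotient_actM g h s : quotient_act (g * h)%g s = quotient_act g (quotient_act h s).
Proof.
have [a ->] := qproj_surj s; rewrite !quotient_actE.
by congr pi; exact: (actM (cstar_actP alpha)).
Qed.

Lemma cstar_act1 a : alpha 1%g a = a.
Proof.
have [/bij_inj inj1 _ _ _ _] := alpha_aut 1%g; apply: inj1.
by have := actM (cstar_actP alpha) 1%g 1%g a; rewrite mul1g.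
Qed.

Lemma quotient_act1 s : quotient_act 1%g s = s.
Proof. by have [a ->] := qproj_surj s; rewrite quotient_actE cstar_act1. Qed.

Lemma quotient_act_strongly_continuous :
  strongly_continuous_action (O := quotient_ops J) quotient_act.
Proof.
split=> [g|g h s|s g e e0]; last 2 first.
- exact: quotient_actM.
- have [a ->] := qproj_surj s.
  have /= := act_continuous (cstar_actP alpha) a g e0; apply: filterS => h.
  rewrite /= !quotient_actE qsubE//; apply: le_lt_trans.
  exact: ler_qnorm_proj.
have [_ aD aM aZ aS] := alpha_aut g.
split.
- exists (quotient_act g^-1%g) => s; rewrite -quotient_actM.
    by rewrite mulVg quotient_act1.
  by rewrite mulgV quotient_act1.
- move=> s t; have [a ->] := qproj_surj s; have [b ->] := qproj_surj t.
  by rewrite /= qaddE// !quotient_actE qaddE//; congr pi; exact: aD.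
- move=> s t; have [a ->] := qproj_surj s; have [b ->] := qproj_surj t.
  by rewrite /= qmulE// !quotient_actE qmulE//; congr pi; exact: aM.
- move=> k s; have [a ->] := qproj_surj s.
  by rewrite /= qscaleE// !quotient_actE qscaleE//; congr pi; exact: aZ.
- move=> s; have [a ->] := qproj_surj s.
  by rewrite /= qstarE// !quotient_actE qstarE//; congr pi; exact: aS.
Qed.

End QuotientAction.

(** * Fibres over the spectrum *)

Section Spectrum.
Variables (R : realType) (C : algType R[i]).
Implicit Types (f g : C) (x : spectrum C).

Let gelfand_character x : character (set_val x).
Proof. exact: set_valP x. Qed.

Lemma gelfandD f g x : gelfand (f + g) x = gelfand f x + gelfand g x.
Proof.
have [lin _] := gelfand_character x.
by have := lin 1 f g; rewrite !scale1r.
Qed.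

Lemma gelfandM f g x : gelfand (f * g) x = gelfand f x * gelfand g x.
Proof. by have [_ [_ xM]] := gelfand_character x; exact: xM. Qed.

Lemma gelfand0 x : gelfand 0 x = 0.
Proof. by apply: (addIr (gelfand 0 x)); rewrite -gelfandD !add0r. Qed.

Lemma gelfandX f n x : gelfand (f ^+ n) x = gelfand f x ^+ n.
Proof.
elim: n => [|n IH]; last by rewrite !exprS gelfandM IH.
by have [_ [x1 _]] := gelfand_character x; exact: x1.
Qed.

Lemma gelfand_scalar (k : R[i]) x : gelfand k%:A x = k.
Proof.
have [lin [one _]] := gelfand_character x.
have := lin k 1 0; rewrite addr0 /gelfand => ->.
by rewrite one -/(gelfand 0 x) gelfand0 addr0; exact: mulr1.
Qed.

Lemma gelfand_continuous f : continuous (gelfand f : spectrum C -> R[i]^o).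
Proof.
move=> x; apply: (@continuous_comp _ _ _ set_val (fun chi : {ptws C -> R[i]^o} => chi f)).
  exact: initial_continuous.
exact: (@proj_continuous C (fun=> R[i]^o) f).
Qed.

End Spectrum.

Section BundleTopology.
Variables (R : realType) (C : algType R[i]) (A : cstarAlgType R) (theta : C -> A).

Lemma cvg_cx_bundle (T : Type) (F : set_system T) (FF : Filter F)
    (f : T -> cx_bundle theta) (s : cx_bundle theta) :
  (forall U a e, open U -> 0 < e -> tube U a e s -> \forall t \near F, tube U a e (f t)) ->
  f @ F --> s.
Proof.
move=> near_tube W; rewrite nbhsE => -[B [[D sD <-] [V DV Vs]] BW].
apply: filterS (BW) _; apply: (@filterS _ F _ (f @^-1` V)).
  by move=> t Vt; exists V.
have [I sI IV] := sD _ DV; rewrite -IV.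
have := @filter_bigI T _ I (fun i => f @^-1` i) F FF.
apply.
move=> i iI; have /set_mem[U [a [e [oU e0 iE]]]] := sI i iI.
rewrite iE; apply: near_tube => //.
by rewrite -iE; move: Vs; rewrite -IV; apply.
Qed.

Lemma open_tube U a e : open U -> 0 < e -> open (tube (theta := theta) U a e).
Proof.
move=> oU e0; exists [set tube U a e]; last by rewrite bigcup_set1.
move=> _ ->; apply: finI_from1.
by exists U, a, e.
Qed.

End BundleTopology.

Section Fibres.
Variables (R : realType) (G : topologicalGroupType) (A : cstarAlgType R).
Variable alpha : cstar_action G A.
Local Notation C := (invariant_centre alpha).
Local Notation theta := (\val : C -> A).
Implicit Types (x : spectrum C) (f : C) (a b : A).

(** Only closure under addition is not formal: [h] divides both [f] and [g] and,
as [h ^+ 4] is a combination of them, it vanishes wherever they both do. Taking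
[f = g] gives closure under the involution, since [h] is self-adjoint. *)
Lemma fibre_ideal_star_ideal x : star_ideal (fibre_ideal theta x).
Proof.
have factor f g : gelfand f x = 0 -> gelfand g x = 0 ->
    exists h, [/\ gelfand h x = 0, star h = h, exists k, f = h * k & exists k, g = h * k].
  move=> fx gx; have [h [sh h4 hf hg]] := common_factor f g.
  have : gelfand h x ^+ 4 == 0.
    by rewrite -gelfandX h4 gelfandD !gelfandM fx gx !mulr0 addr0.
  by rewrite expf_eq0 => /eqP hx; exists h.
split.
- by exists 0; [exact: gelfand0|exists 0 => //; rewrite mulr0].
- move=> _ _ [f fx [a _ <-]] [g gx [b _ <-]].
  have [h [hx _ [k ->] [l ->]]] := factor f g fx gx.
  exists h => //; exists (\val k * a - \val l * b) => //.
  by rewrite mulrBr !mulrA.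
- move=> b _ [f fx [a _ <-]]; exists f => //; exists (b * a) => //.
  by rewrite !mulrA central_val.
- move=> _ b [f fx [a _ <-]]; exists f => //; exists (a * b) => //.
  by rewrite mulrA.
- move=> _ [f fx [a _ <-]]; have [h [hx sh [k ->] _]] := factor f f fx fx.
  exists h => //; exists (star (\val k * a)) => //.
  have svh : star (\val h) = \val h by rewrite -[in RHS]sh.
  by rewrite /= -mulrA [RHS]starM svh central_val.
Qed.

Lemma fibre_ideal_invariant x g a :
  fibre_ideal theta x a -> fibre_ideal theta x (alpha g a).
Proof.
have [_ _ aM _ _] := act_aut (cstar_actP alpha) g.
move=> [f fx [b _ <-]]; exists f => //; exists (alpha g b) => //.
by rewrite [RHS](aM (\val f) b) invariant_val.
Qed.

(** Upper semicontinuity of the norm: if [a + f b] is small and [f] vanishes at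
[x], then [f - f y] vanishes at [y] and [a + (f - f y) b] is still small for [y]
close to [x]. *)
Lemma near_fibre_norm x a e : qnorm (fibre_proj theta x a) < e ->
  \forall y \near x, qnorm (fibre_proj theta y a) < e.
Proof.
move=> /(qnorm_ltP (fibre_ideal_star_ideal x))[_ [f fx [b _ <-]] fe].
pose d := e - cnorm (a + \val f * b).
pose r := d / (cnorm b + 1).
have b0 := cnorm_ge0 b.
have d0 : 0 < d by rewrite subr_gt0.
have r0 : 0 < r%:C :> R[i] by rewrite ltcR divr_gt0// ltr_wpDl.
have /cvgrPdist_lt/(_ _ r0) := @gelfand_continuous _ _ f x.
apply: filterS => y; rewrite fx sub0r normrN => fy.
apply/(qnorm_ltP (fibre_ideal_star_ideal y)).
exists ((\val f - (gelfand f y)%:A) * b).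
  exists (f - (gelfand f y)%:A).
    by rewrite /= -scaleNr gelfandD gelfand_scalar subrr.
  by exists b.
rewrite mulrBl addrA; apply: (le_lt_trans (ler_cnormB _ _)).
rewrite -ltrBrDl -/d mulr_algl.
rewrite -ltcR cnormZ.
apply: (@le_lt_trans _ _ (r%:C * (cnorm b)%:C)).
  by apply: ler_wpM2r; [rewrite lecR|exact: ltW].
by rewrite -rmorphM/= ltcR /r mulrAC ltr_pdivrMr ?ltr_pM2l ?ltrDl// ltr_wpDl.
Qed.

Definition fibre_act x (g : G) : fibre theta x -> fibre theta x :=
  @quotient_act R G A alpha (fibre_ideal theta x) g.

Lemma fibre_actE x g a :
  fibre_act g (fibre_proj theta x a) = fibre_proj theta x (alpha g a).
Proof.
apply: quotient_actE; first exact: fibre_ideal_star_ideal.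
by move=> h b; exact: fibre_ideal_invariant.
Qed.

Lemma fibre_act_dist x g h a b (s : fibre theta x) (d1 d2 d3 : R) :
  qnorm (qsub s (fibre_proj theta x b)) < d1 -> cnorm (alpha h b - alpha g b) < d2 ->
  qnorm (fibre_proj theta x (alpha g b - a)) < d3 ->
  qnorm (qsub (fibre_act h s) (fibre_proj theta x a)) < d1 + d2 + d3.
Proof.
have Jx := fibre_ideal_star_ideal x.
have [c ->] := qproj_surj s; rewrite fibre_actE !qsubE// => cb hg ga.
have -> : alpha h c - a = alpha h (c - b) + (alpha h b - alpha g b) + (alpha g b - a).
  rewrite (star_automorphismB (act_aut (cstar_actP alpha) h)).
  by rewrite !addrA !subrK.
apply: qnorm_ltD => //; apply: qnorm_ltD => //.
  have Jinv k := @fibre_ideal_invariant x k.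
  by rewrite -(quotient_actE Jx Jinv); exact: quotient_act_contract.
by apply: le_lt_trans hg; exact: ler_qnorm_proj.
Qed.

(** Near a point [(x, g, s)] with [s] the class of [b], the class of
[alpha g' b'] is compared with that of [a] through [alpha g' b] and [alpha g b]:
the three differences are controlled by contractivity of the action, by its
strong continuity at [b], and by semicontinuity of the norm. *)
Lemma fibre_act_continuous :
  {within [set p : (spectrum C * G) * cx_bundle theta | p.1.1 = cx_bundle_proj p.2],
    continuous (bundle_act (@fibre_act))}.
Proof.
apply/subspace_continuousP => -[[x g] [y s]] /= xy.
move: s; rewrite -{}[y]xy => s; have [b sb] := qproj_surj s.
apply: cvg_cx_bundle => U a e oU e0 [/= Ux sa].
have Jx := fibre_ideal_star_ideal x.
have norm_lt : qnorm (fibre_proj theta x (alpha g b - a)) < e.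
  by move: sa; rewrite sb fibre_actE qsubE.
pose n := qnorm (fibre_proj theta x (alpha g b - a)).
pose d := (e - n) / 3.
have d0 : 0 < d by rewrite divr_gt0// subr_gt0.
near=> p.
have pD : p.1.1 = cx_bundle_proj p.2 by near: p; exact: withinT.
have pU : U p.1.1.
  near: p; apply: cvg_within; have := open_nbhs_nbhs (conj oU Ux).
  by apply: (cvg_comp _ _ cvg_fst cvg_fst).
have pn : qnorm (fibre_proj theta p.1.1 (alpha g b - a)) < n + d.
  near: p; apply: cvg_within.
  have := @near_fibre_norm x (alpha g b - a) (n + d).
  rewrite ltrDl => /(_ d0).
  by apply: (cvg_comp _ _ cvg_fst cvg_fst).
have pg : cnorm (alpha p.1.2 b - alpha g b) < d.
  near: p; apply: cvg_within.
  have := act_continuous (cstar_actP alpha) b g d0.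
  by apply: (cvg_comp _ _ cvg_fst cvg_snd).
have [_ pb] : tube setT b d p.2.
  near: p; apply: cvg_within.
  have : nbhs (existT (fibre theta) x s : cx_bundle theta) (tube setT b d).
    apply: open_nbhs_nbhs; split; first by apply: open_tube => //; exact: openT.
    split=> //=; rewrite sb qsubE// subrr.
    by apply: (le_lt_trans (ler_qnorm_proj Jx 0)); rewrite cnorm0.
  by apply: cvg_snd.
rewrite pD in pU pn; split=> //=.
have -> : e = d + d + (n + d) by rewrite /d; field.
exact: fibre_act_dist pb pg pn.
Unshelve. all: by end_near. Qed.

End Fibres.

Theorem corollary3p4 (R : realType) (A : cstarAlgType R)
    (G : topologicalGroupType) (G_lc : locally_compact [set: G]%classic)
    (alpha : cstar_action G A) :
  let theta := (\val : invariant_centre alpha -> A) in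
  exists! act : forall x : spectrum (invariant_centre alpha),
      G -> fibre theta x -> fibre theta x,
    fibred_action act /\
    forall g x a, act x g (fibre_proj theta x a) = fibre_proj theta x (alpha g a).
Proof.
move=> theta; exists (@fibre_act R G A alpha); split.
  split; last by move=> g x a; exact: fibre_actE.
  split=> [x|]; last exact: fibre_act_continuous.
  apply: quotient_act_strongly_continuous; first exact: fibre_ideal_star_ideal.
  by move=> g a; exact: fibre_ideal_invariant.
move=> act [_ actE]; apply/functional_extensionality_dep => x.
apply/funext => g; apply/funext => s.
by have [a ->] := qproj_surj s; rewrite [RHS]actE; exact: fibre_actE.
Qed.
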